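(* Only finite game values occur for positions in infinite Hex. That is, for either player, if a position in infinite Hex has a game value for that player, then this value is a finite ordinal.
   Context: Board: the infinite hexagonal lattice. Tiles are indexed by $(a,b)\in\mathbb{Z}^2$, tile $(a,b)$ being centered at $(x,y)=(a+\tfrac{b}{2},\tfrac{\sqrt3}{2}b)$; it is adjacent to $(a\pm1,b)$, $(a,b\pm1)$, $(a+1,b-1)$, $(a-1,b+1)$. Infinite Hex: Red and Blue alternately place one stone of their own color on an empty tile; stones are never moved or removed. A position consists of an arbitrary partial coloring of the tiles by red and blue (possibly with infinitely many stones) together with the information whose turn it is. A red $\mathbb{Z}$-chain is a sequence $(h_n)_{n\in\mathbb{Z}}$ of red tiles with $h_n$ adjacent to $h_{n+1}$ for all $n$; similarly for blue. Red's winning condition: there is a red $\mathbb{Z}$-chain converging to $(\infty,\infty)$ as $n\to+\infty$ (both coordinates of the tile centers tend to $+\infty$) and to $(-\infty,-\infty)$ as $n\to-\infty$. Blue's winning condition: there is a blue $\mathbb{Z}$-chain converging to $(-\infty,\infty)$ at one end and to $(\infty,-\infty)$ at the other. Game value for a player $P$ (an ordinal, defined by recursion for some positions): a position has value $0$ if the game is already won for $P$, i.e. the stones of $P$ already on the board fulfill $P$'s winning condition (so that no subsequent moves can prevent the win). If the position is not already won, it is $P$'s turn, and $P$ has a move to a position with a value, then with $\alpha$ the minimal value of such a position, the value is $\alpha+1$. If the position is not already won, it is the opponent's turn, there is at least one legal move, and every legal move leads to a position with a value, then the value is the supremum of those values. Positions not assigned a value in this way have no game value for $P$. *)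

(* Defs.v *)
From Stdlib Require Import Reals ZArith Classical ClassicalEpsilon.
From Coquelicot Require Import Coquelicot.

(** * Ordinals *)

(** [ord_lim I f] is the least ordinal strictly above every [f i].  Ordinals
    are identified up to [ord_eq], not up to Leibniz equality. *)
Inductive Ord : Type := ord_lim (I : Type) (f : I -> Ord).

Fixpoint ord_le (a b : Ord) {struct a} : Prop :=
  match a, b with
  | ord_lim _ f, ord_lim _ g => forall i, exists j, ord_le (f i) (g j)
  end.

Definition ord_lt (a b : Ord) : Prop :=
  match b with ord_lim _ g => exists j, ord_le a (g j) end.

Definition ord_eq (a b : Ord) : Prop := ord_le a b /\ ord_le b a.

Definition ord_zero : Ord := ord_lim Empty_set (fun e => match e with end).

Definition ord_succ (a : Ord) : Ord := ord_lim unit (fun _ => a).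

Fixpoint ord_of_nat (n : nat) : Ord :=
  match n with O => ord_zero | S m => ord_succ (ord_of_nat m) end.

Definition ord_finite (a : Ord) : Prop := exists n : nat, ord_eq a (ord_of_nat n).

Definition ord_is_min (S : Ord -> Prop) (a : Ord) : Prop :=
  S a /\ forall b, S b -> ord_le a b.

Definition ord_is_sup (S : Ord -> Prop) (a : Ord) : Prop :=
  (forall b, S b -> ord_le b a) /\
  (forall c, (forall b, S b -> ord_le b c) -> ord_le a c).

(** * The board *)

Definition tile : Type := (Z * Z)%type.

Definition tile_eq_dec (s t : tile) : {s = t} + {s <> t}.
Proof. decide equality; apply Z.eq_dec. Defined.

Definition adjacent (s t : tile) : Prop :=
  let (a, b) := s in
  t = (a + 1, b)%Z \/ t = (a - 1, b)%Z \/
  t = (a, b + 1)%Z \/ t = (a, b - 1)%Z \/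
  t = (a + 1, b - 1)%Z \/ t = (a - 1, b + 1)%Z.

Definition center_x (t : tile) : R := (IZR (fst t) + IZR (snd t) / 2)%R.
Definition center_y (t : tile) : R := (sqrt 3 / 2 * IZR (snd t))%R.

(** * Infinite Hex *)

Inductive player : Set := Red | Blue.

Definition opponent (P : player) : player :=
  match P with Red => Blue | Blue => Red end.

Record position : Type := Position {
  stone : tile -> option player;
  turn : player
}.

Definition legal (p : position) (t : tile) : Prop := stone p t = None.

Definition play (p : position) (t : tile) : position :=
  Position
    (fun s => if tile_eq_dec s t then Some (turn p) else stone p s)
    (opponent (turn p)).

Definition is_chain (P : player) (p : position) (h : Z -> tile) : Prop :=
  (forall n : Z, stone p (h n) = Some P) /\
  (forall n : Z, adjacent (h n) (h (n + 1)%Z)).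

Definition tends_forward (h : Z -> tile) (lx ly : Rbar) : Prop :=
  is_lim_seq (fun k : nat => center_x (h (Z.of_nat k))) lx /\
  is_lim_seq (fun k : nat => center_y (h (Z.of_nat k))) ly.

Definition tends_backward (h : Z -> tile) (lx ly : Rbar) : Prop :=
  is_lim_seq (fun k : nat => center_x (h (- Z.of_nat k)%Z)) lx /\
  is_lim_seq (fun k : nat => center_y (h (- Z.of_nat k)%Z)) ly.

Definition red_won (p : position) : Prop :=
  exists h : Z -> tile,
    is_chain Red p h /\
    tends_forward h p_infty p_infty /\ tends_backward h m_infty m_infty.

Definition blue_won (p : position) : Prop :=
  exists h : Z -> tile,
    is_chain Blue p h /\
    ((tends_forward h m_infty p_infty /\ tends_backward h p_infty m_infty) \/
     (tends_forward h p_infty m_infty /\ tends_backward h m_infty p_infty)).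

Definition won (P : player) (p : position) : Prop :=
  match P with Red => red_won p | Blue => blue_won p end.

(** * Game values *)

(** The values, according to [V], of the positions reachable from [p] in one
    move; [V q a] reads "[q] has value [a]". *)
Definition option_value (V : position -> Ord -> Prop) (p : position) (a : Ord)
  : Prop :=
  exists t : tile, legal p t /\ V (play p t) a.

Definition value_clause (P : player) (V : position -> Ord -> Prop)
    (p : position) (a : Ord) : Prop :=
  (won P p /\ ord_eq a ord_zero)
  \/
  (~ won P p /\ turn p = P /\
   exists b : Ord, ord_is_min (option_value V p) b /\ ord_eq a (ord_succ b))
  \/
  (~ won P p /\ turn p = opponent P /\
   (exists t : tile, legal p t) /\
   (forall t : tile, legal p t -> exists b : Ord, V (play p t) b) /\
   ord_is_sup (option_value V p) a).

Definition is_valuation (P : player) (V : position -> Ord -> Prop) : Prop :=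
  forall (p : position) (a : Ord), V p a <-> value_clause P V p a.

(** The recursion has exactly one solution: its existence, its uniqueness and
    the uniqueness of the value of a position are [has_value_is_valuation],
    [valuation_unique] and [has_value_functional] below. *)
Definition has_value (P : player) (p : position) (a : Ord) : Prop :=
  exists V : position -> Ord -> Prop, is_valuation P V /\ V p a.

(** * The order on ordinals *)

Lemma ord_le_refl (a : Ord) : ord_le a a.
Proof. induction a as [I f IH]; simpl; intro i; exists i; apply IH. Qed.

Lemma ord_le_trans (a b c : Ord) : ord_le a b -> ord_le b c -> ord_le a c.
Proof.
revert b c; induction a as [I f IH]; intros [J g] [K h]; simpl; intros H1 H2 i.
destruct (H1 i) as [j Hj]; destruct (H2 j) as [k Hk]; exists k.
exact (IH i _ _ Hj Hk).
Qed.

Lemma ord_lt_le_trans (a b c : Ord) : ord_lt a b -> ord_le b c -> ord_lt a c.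
Proof.
destruct b as [J g], c as [K h]; simpl; intros [j Hj] H.
destruct (H j) as [k Hk]; exists k; exact (ord_le_trans _ _ _ Hj Hk).
Qed.

Lemma ord_le_lt_trans (a b c : Ord) : ord_le a b -> ord_lt b c -> ord_lt a c.
Proof.
destruct c as [K h]; simpl; intros H [k Hk]; exists k.
exact (ord_le_trans _ _ _ H Hk).
Qed.

Lemma ord_lt_irrefl (a : Ord) : ~ ord_lt a a.
Proof.
induction a as [I f IH]; simpl; intros [i Hi]; apply (IH i).
revert Hi; destruct (f i) as [J g] eqn:E; simpl; intro Hi.
destruct (Hi i) as [j Hj]; rewrite E in Hj; exists j; exact Hj.
Qed.

Lemma ord_lt_le (a b : Ord) : ord_lt a b -> ord_le a b.
Proof.
revert b; induction a as [I f IH]; intros [J g] [j Hj]; simpl; intro i.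
exists j; apply IH; destruct (g j) as [K h]; exact (Hj i).
Qed.

Lemma ord_le_or_lt (a b : Ord) : ord_le a b \/ ord_lt b a.
Proof.
revert b; induction a as [I f IH]; intro b.
destruct (classic (ord_le (ord_lim I f) b)) as [H | H]; [now left | right].
destruct b as [J g]; simpl in *.
apply not_all_ex_not in H; destruct H as [i Hi]; exists i.
assert (Hj : forall j, ord_lt (g j) (f i)).
{ intro j; destruct (IH i (g j)) as [H | H]; [| exact H].
  exfalso; apply Hi; exists j; exact H. }
destruct (f i) as [K h]; exact Hj.
Qed.

Lemma ord_lt_wf : well_founded ord_lt.
Proof.
assert (H : forall a b, ord_le b a -> Acc ord_lt b).
{ induction a as [I f IH]; intros b Hb; constructor; intros c Hc.
  destruct (ord_lt_le_trans _ _ _ Hc Hb) as [i Hi]; exact (IH i _ Hi). }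
intro a; exact (H a a (ord_le_refl a)).
Qed.

Lemma ord_min_exists (S : Ord -> Prop) :
  (exists a, S a) -> exists a, ord_is_min S a.
Proof.
intros [a Ha]; apply NNPP; intro Hno; revert Ha.
induction a as [a IH] using (well_founded_ind ord_lt_wf); intro Ha.
apply Hno; exists a; split; [exact Ha | intros b Hb].
destruct (ord_le_or_lt a b) as [H | H]; [exact H | exfalso; exact (IH b H Hb)].
Qed.

Lemma ord_succ_mono (a b : Ord) : ord_le a b -> ord_le (ord_succ a) (ord_succ b).
Proof. intros H i; exists tt; exact H. Qed.

Lemma ord_lt_succ (a : Ord) : ord_lt a (ord_succ a).
Proof. exists tt; apply ord_le_refl. Qed.

Lemma ord_succ_le (a b : Ord) : ord_lt a b -> ord_le (ord_succ a) b.
Proof. destruct b as [J g]; intros [j Hj] i; exists j; exact Hj. Qed.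

Lemma ord_zero_le (a : Ord) : ord_le ord_zero a.
Proof. destruct a as [I f]; intros []. Qed.

Lemma ord_eq_refl (a : Ord) : ord_eq a a.
Proof. split; apply ord_le_refl. Qed.

Definition ord_index (a : Ord) : Type := match a with ord_lim J _ => J end.

Definition ord_child (a : Ord) : ord_index a -> Ord :=
  match a with ord_lim _ f => f end.

Lemma ord_sup_exists (I : Type) (f : I -> Ord) :
  exists a, ord_is_sup (fun b => exists i, f i = b) a.
Proof.
exists (ord_lim {i : I & ord_index (f i)} (fun s => ord_child (f (projT1 s)) (projT2 s))).
split.
- intros b [i Hi]; subst b; destruct (f i) as [J g] eqn:E; intro j.
  assert (k : {k : ord_index (f i) | ord_child (f i) k = g j}).
  { rewrite E; exists j; reflexivity. }
  destruct k as [k Hk]; exists (existT _ i k); simpl; rewrite Hk.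
  apply ord_le_refl.
- intros [K h] Hc [i k]; simpl.
  assert (H : ord_le (f i) (ord_lim K h)) by (apply Hc; exists i; reflexivity).
  destruct (f i) as [J g]; exact (H k).
Qed.

(** * Well-definedness of game values *)

(** [P] can force a win from [p] in a way witnessed by the ordinal [a]; the
    value of [p] is the least such [a]. *)
Inductive wins_within (P : player) : Ord -> position -> Prop :=
| ww_won a p : won P p -> wins_within P a p
| ww_self a b p t : turn p = P -> legal p t -> ord_lt b a ->
    wins_within P b (play p t) -> wins_within P a p
| ww_opponent a p : turn p = opponent P -> (exists t, legal p t) ->
    (forall t, legal p t -> wins_within P a (play p t)) -> wins_within P a p.

Lemma wins_within_mono (P : player) (a b : Ord) (p : position) :
  wins_within P a p -> ord_le a b -> wins_within P b p.
Proof.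
intro H; revert b; induction H as [a p W | a c p t T L C H IH | a p T E H IH];
  intros b Hb.
- now apply ww_won.
- exact (ww_self P b c p t T L (ord_lt_le_trans _ _ _ C Hb) H).
- apply ww_opponent; auto.
Qed.

Lemma opponent_neq (P : player) : P <> opponent P.
Proof. now destruct P. Qed.

Definition least_bound (P : player) (p : position) (a : Ord) : Prop :=
  ord_is_min (fun b => wins_within P b p) a.

Lemma least_bound_exists (P : player) (p : position) (a : Ord) :
  wins_within P a p -> exists b, least_bound P p b.
Proof. intro H; apply ord_min_exists; exists a; exact H. Qed.

Lemma least_bound_is_valuation (P : player) : is_valuation P (least_bound P).
Proof.
intros p a; split.
- intros [W M].
  destruct (classic (won P p)) as [Hw | Hw].
  { left; split; [exact Hw | split; [| apply ord_zero_le]].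
    apply M; now apply ww_won. }
  right; destruct W as [a p W | a b p t T L C W | a p T E W].
  + now elim Hw.
  + left; split; [exact Hw | split; [exact T |]].
    destruct (ord_min_exists
      (fun c => exists s, legal p s /\ wins_within P c (play p s)))
      as [c [[s [Ls Ws]] Mc]]; [now exists b, t |].
    exists c; split; split.
    * exists s; split; [exact Ls | split; [exact Ws |]].
      intros d Hd; apply Mc; now exists s.
    * intros d [u [Lu [Wu _]]]; apply Mc; now exists u.
    * apply M; exact (ww_self P _ c p s T Ls (ord_lt_succ c) Ws).
    * apply ord_succ_le; apply ord_le_lt_trans with b; [| exact C].
      apply Mc; now exists t.
  + right; split; [exact Hw | split; [exact T | split; [exact E | split]]].
    { intros t L; exact (least_bound_exists _ _ _ (W t L)). }
    split.
    * intros b [t [L [_ Mb]]]; exact (Mb a (W t L)).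
    * intros c Hc; apply M; apply ww_opponent; [exact T | exact E |].
      intros t L; destruct (least_bound_exists _ _ _ (W t L)) as [b Hb].
      apply wins_within_mono with b; [apply Hb |].
      apply Hc; now exists t.
- intros [[Hw Ha] | [[Hw [T [b [[[t [L [W Mb]]] Mo] Ha]]]] | [Hw [T [E [Hv [U Lst]]]]]]].
  + split; [now apply ww_won |].
    intros b _; exact (ord_le_trans _ _ _ (proj1 Ha) (ord_zero_le b)).
  + split.
    { apply (ww_self P a b p t T L); [| exact W].
      exact (ord_lt_le_trans _ _ _ (ord_lt_succ b) (proj2 Ha)). }
    intros c Wc; apply ord_le_trans with (ord_succ b); [apply Ha |].
    destruct Wc as [c p W' | c d p s T' L' C W' | c p T' E W'].
    * now elim Hw.
    * apply ord_succ_le; apply ord_le_lt_trans with d; [| exact C].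
      destruct (least_bound_exists _ _ _ W') as [e He].
      apply ord_le_trans with e; [apply Mo; now exists s |].
      exact (proj2 He d W').
    * elim (opponent_neq P); congruence.
  + split.
    { apply ww_opponent; [exact T | exact E |].
      intros t L; destruct (Hv t L) as [b Hb].
      apply wins_within_mono with b; [apply Hb |].
      apply U; now exists t. }
    intros c Wc; apply Lst; intros b [t [L [_ Mb]]]; apply Mb.
    destruct Wc as [c p W' | c d p s T' L' C W' | c p T' E' W'].
    * now elim Hw.
    * elim (opponent_neq P); congruence.
    * exact (W' t L).
Qed.

Lemma turn_cases (P : player) (p : position) : turn p = P \/ turn p = opponent P.
Proof. destruct P, (turn p); simpl; auto. Qed.

Lemma turn_play (P : player) (p : position) (t : tile) :
  turn p = opponent P -> turn (play p t) = P.
Proof. simpl; intro H; rewrite H; now destruct P. Qed.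

Lemma ord_min_unique (S : Ord -> Prop) (a b : Ord) :
  ord_is_min S a -> ord_is_min S b -> ord_eq a b.
Proof. intros [Sa Ma] [Sb Mb]; split; auto. Qed.

Lemma ord_sup_unique (S : Ord -> Prop) (a b : Ord) :
  ord_is_sup S a -> ord_is_sup S b -> ord_eq a b.
Proof. intros [Ua La] [Ub Lb]; split; auto. Qed.

Lemma valuation_functional (P : player) (V : position -> Ord -> Prop)
    (p : position) (a b : Ord) :
  is_valuation P V -> V p a -> V p b -> ord_eq a b.
Proof.
intros HV Ha Hb; apply HV in Ha; apply HV in Hb.
destruct Ha as [[Wa Ea] | [[Wa [Ta [c [Mc Ea]]]] | [Wa [Ta [_ [_ Sa]]]]]];
destruct Hb as [[Wb Eb] | [[Wb [Tb [d [Md Eb]]]] | [Wb [Tb [_ [_ Sb]]]]]];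
try contradiction; try (elim (opponent_neq P); congruence).
- split; [exact (ord_le_trans _ _ _ (proj1 Ea) (proj2 Eb))
         | exact (ord_le_trans _ _ _ (proj1 Eb) (proj2 Ea))].
- destruct (ord_min_unique _ _ _ Mc Md) as [H1 H2]; split.
  + exact (ord_le_trans _ _ _ (proj1 Ea)
      (ord_le_trans _ _ _ (ord_succ_mono _ _ H1) (proj2 Eb))).
  + exact (ord_le_trans _ _ _ (proj1 Eb)
      (ord_le_trans _ _ _ (ord_succ_mono _ _ H2) (proj2 Ea))).
- exact (ord_sup_unique _ _ _ Sa Sb).
Qed.

Lemma clause_self (P : player) (U U' : position -> Ord -> Prop)
    (p : position) (a : Ord) :
  (forall q b, ord_lt b a -> (U q b <-> U' q b)) ->
  turn p = P -> value_clause P U p a -> value_clause P U' p a.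
Proof.
intros H HT [C | [[Hw [T [b [[[t [L Vt]] M] E]]]] | [Hw [T _]]]].
- now left.
- right; left; split; [exact Hw | split; [exact T |]]; exists b.
  assert (Hb : ord_lt b a)
    by exact (ord_lt_le_trans _ _ _ (ord_lt_succ b) (proj2 E)).
  split; [split | exact E].
  + exists t; split; [exact L | now apply H].
  + intros c [s [Ls Vs]].
    destruct (ord_le_or_lt b c) as [Hc | Hc]; [exact Hc |].
    apply M; exists s; split; [exact Ls |].
    apply H; [| exact Vs].
    exact (ord_lt_le_trans _ _ _ Hc (ord_lt_le _ _ Hb)).
- elim (opponent_neq P); congruence.
Qed.

Lemma clause_opponent (P : player) (U U' : position -> Ord -> Prop)
    (p : position) (a : Ord) :
  is_valuation P U' ->
  (forall q b, turn q = P -> ord_le b a -> U q b -> U' q b) ->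
  turn p = opponent P -> value_clause P U p a -> value_clause P U' p a.
Proof.
intros F H HT [C | [[_ [T _]] | [Hw [T [E [Hv [Ub Lst]]]]]]].
- now left.
- elim (opponent_neq P); congruence.
- right; right; split; [exact Hw | split; [exact T | split; [exact E |]]].
  assert (Hv' : forall t, legal p t ->
    exists b, U (play p t) b /\ U' (play p t) b).
  { intros t L; destruct (Hv t L) as [b Hb]; exists b; split; [exact Hb |].
    apply H; [now apply turn_play | apply Ub; now exists t | exact Hb]. }
  split; [intros t L; destruct (Hv' t L) as [b [_ Hb]]; now exists b |].
  split.
  + intros c [t [L Hc]]; destruct (Hv' t L) as [b [Hb Hb']].
    apply ord_le_trans with b; [| apply Ub; now exists t].
    apply (valuation_functional P U' (play p t) c b F Hc Hb').
  + intros c Hc; apply Lst; intros b [t [L Hb]].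
    apply Hc; exists t; split; [exact L |].
    apply H; [now apply turn_play | apply Ub; now exists t | exact Hb].
Qed.

Lemma valuation_unique (P : player) (V V' : position -> Ord -> Prop) :
  is_valuation P V -> is_valuation P V' -> forall p a, V p a <-> V' p a.
Proof.
intros HV HV'.
assert (Hself : forall a q, turn q = P -> (forall r b, ord_lt b a -> (V r b <-> V' r b)) ->
  (V q a <-> V' q a)).
{ intros a q T H; split; intro Hq.
  - apply HV'; apply HV in Hq; exact (clause_self P V V' q a H T Hq).
  - apply HV; apply HV' in Hq; apply (clause_self P V' V q a); auto.
    intros r b Hb; symmetry; auto. }
assert (Hall : forall a q, (forall r b, ord_lt b a -> (V r b <-> V' r b)) ->
  (V q a <-> V' q a)).
{ intros a q H; destruct (turn_cases P q) as [T | T]; [now apply Hself |].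
  assert (H' : forall r b, turn r = P -> ord_le b a -> (V r b <-> V' r b)).
  { intros r b Tr Hb; apply Hself; [exact Tr |].
    intros s c Hc; apply H; exact (ord_lt_le_trans _ _ _ Hc Hb). }
  split; intro Hq.
  - apply HV'; apply HV in Hq; apply (clause_opponent P V V' q a); auto.
    intros r b Tr Hb; apply H'; auto.
  - apply HV; apply HV' in Hq; apply (clause_opponent P V' V q a); auto.
    intros r b Tr Hb; apply H'; auto. }
intros p a; revert p.
induction a as [a IH] using (well_founded_ind ord_lt_wf); intro p.
apply Hall; intros r b Hb; apply IH; exact Hb.
Qed.

Lemma value_clause_ext (P : player) (V V' : position -> Ord -> Prop)
    (p : position) (a : Ord) :
  (forall q b, V q b <-> V' q b) -> value_clause P V p a -> value_clause P V' p a.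
Proof.
intros H C; destruct (turn_cases P p) as [T | T].
- apply (clause_self P V V' p a); auto.
- destruct C as [C | [[_ [T' _]] | [Hw [_ [E [Hv [U L]]]]]]].
  + now left.
  + elim (opponent_neq P); congruence.
  + right; right; repeat split; auto.
    * intros t Lt; destruct (Hv t Lt) as [b Hb]; exists b; now apply H.
    * intros b [t [Lt Hb]]; apply U; exists t; split; [exact Lt | now apply H].
    * intros c Hc; apply L; intros b [t [Lt Hb]]; apply Hc; exists t.
      split; [exact Lt | now apply H].
Qed.

Lemma has_value_iff (P : player) (p : position) (a : Ord) :
  has_value P p a <-> least_bound P p a.
Proof.
split.
- intros [V [HV Va]].
  exact (proj1 (valuation_unique P _ _ HV (least_bound_is_valuation P) p a) Va).
- intro H; exists (least_bound P); split; [apply least_bound_is_valuation | exact H].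
Qed.

Theorem has_value_is_valuation (P : player) : is_valuation P (has_value P).
Proof.
intros p a; rewrite has_value_iff; split; intro H.
- apply (value_clause_ext P (least_bound P)).
  + intros q b; symmetry; apply has_value_iff.
  + now apply least_bound_is_valuation.
- apply least_bound_is_valuation; apply (value_clause_ext P (has_value P)).
  + apply has_value_iff.
  + exact H.
Qed.

Theorem has_value_functional (P : player) (p : position) (a b : Ord) :
  has_value P p a -> has_value P p b -> ord_eq a b.
Proof. exact (valuation_functional P _ p a b (has_value_is_valuation P)). Qed.

(** [Ord] is large enough for the suprema in the recursion to exist. *)
Theorem has_value_opponent_move (P : player) (p : position) :
  ~ won P p -> turn p = opponent P -> (exists t, legal p t) ->
  (forall t, legal p t -> exists b, has_value P (play p t) b) ->
  exists a, has_value P p a.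
Proof.
intros Hw T E Hv.
set (f := fun s : {t : tile | legal p t} =>
  constructive_indefinite_description _ (Hv (proj1_sig s) (proj2_sig s))).
destruct (ord_sup_exists _ (fun s => proj1_sig (f s))) as [a [U L]].
exists a; apply has_value_is_valuation; right; right.
split; [exact Hw | split; [exact T | split; [exact E | split; [exact Hv |]]]].
split.
- intros b [t [Lt Hb]]; set (s := exist (legal p) t Lt).
  apply ord_le_trans with (proj1_sig (f s)); [| apply U; now exists s].
  exact (proj1 (has_value_functional P _ _ _ Hb (proj2_sig (f s)))).
- intros c Hc; apply L; intros b [s Hs]; subst b; apply Hc.
  exists (proj1_sig s); split; [exact (proj2_sig s) | exact (proj2_sig (f s))].
Qed.

(* Main.v *)
From Stdlib Require Import List Arith Classical.
Require Import Defs.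
Import ListNotations.

(** The one fact about the winning condition behind the proof is that it asks
    only for stones of [P], so that further stones of [P] cannot spoil it and
    stones of the opponent matter only by occupying tiles.  This lets [P] confine
    the play to a finite set of tiles: for each position that [P] can win, there
    are a finite set inside which [P] can make all moves and a finite bound on
    their number ([wins_within_has_carrier]).

    The set is built by induction on a winning strategy.  A won position needs
    no tiles, and a move of [P] adds one tile.  The infinitely many moves of the
    opponent are dealt with as follows.  Fix any one legal move [t0] of the
    opponent; by induction [P] wins after it inside a finite set [K0].  If the
    opponent plays instead outside [K0], then [P] pretends that the move was
    [t0] and wins inside [K0]: the stone actually played does not touch [K0],
    and [P] is not hurt by the absence of the imagined stone at [t0].  So only
    the finitely many moves in [K0] call for answers of their own, and the union
    of finitely many finite sets, with the maximum of finitely many bounds,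
    serves for all moves of the opponent.  Hence a position that can be won at
    all can be won within some natural number, and an ordinal below a natural
    number is finite. *)

Lemma ord_of_nat_le (m n : nat) : m <= n -> ord_le (ord_of_nat m) (ord_of_nat n).
Proof.
induction 1 as [| n _ IH]; [apply ord_le_refl |].
exact (ord_le_trans _ _ _ IH (ord_lt_le _ _ (ord_lt_succ _))).
Qed.

Lemma ord_le_nat_finite (a : Ord) (n : nat) : ord_le a (ord_of_nat n) -> ord_finite a.
Proof.
induction n as [| n IH]; intro H.
- exists 0; split; [exact H | apply ord_zero_le].
- destruct (ord_le_or_lt a (ord_of_nat n)) as [Hle | Hlt]; [now apply IH |].
  exists (S n); split; [exact H | now apply ord_succ_le].
Qed.

Lemma won_mono (P : player) (p q : position) :
  (forall s, stone p s = Some P -> stone q s = Some P) -> won P p -> won P q.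
Proof.
intro H; destruct P; intros [h [[Hs Ha] Hl]]; exists h;
  (split; [split; [intro k; apply H, Hs | exact Ha] | exact Hl]).
Qed.

(** What a strategy of [P] for [p] that plays only inside [K] needs in order to
    work from [q]: the stones of [P] it builds on, and the tiles of [K] it may
    want to occupy.  Those tiles must be empty in [q], not merely free of the
    opponent: were the next move of the strategy already occupied by [P], a
    replacement move would have to be found. *)
Definition agrees_on (P : player) (K : list tile) (p q : position) : Prop :=
  turn q = turn p /\
  (forall s, stone p s = Some P -> stone q s = Some P) /\
  (forall s, In s K -> legal p s -> legal q s).

(** [K] is a carrier, in the sense of finite Hex, of a win in at most [n]
    moves.  Quantifying over all positions that look like [p] on [K] avoids
    speaking of strategies and of play restricted to [K]. *)
Definition carries (P : player) (K : list tile) (n : nat) (p : position) : Prop :=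
  forall q, agrees_on P K p q -> wins_within P (ord_of_nat n) q.

Lemma agrees_on_refl (P : player) (K : list tile) (p : position) : agrees_on P K p p.
Proof. repeat split; auto. Qed.

Lemma agrees_on_incl (P : player) (K L : list tile) (p q : position) :
  incl K L -> agrees_on P L p q -> agrees_on P K p q.
Proof. intros H [T [S E]]; repeat split; auto. Qed.

Lemma carries_mono (P : player) (K L : list tile) (m n : nat) (p : position) :
  incl K L -> m <= n -> carries P K m p -> carries P L n p.
Proof.
intros HK Hn C q A; apply wins_within_mono with (ord_of_nat m).
- apply C; exact (agrees_on_incl _ _ _ _ _ HK A).
- now apply ord_of_nat_le.
Qed.

Lemma agrees_on_play (P : player) (K : list tile) (p q : position) (t : tile) :
  agrees_on P K p q -> agrees_on P K (play p t) (play q t).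
Proof.
intros [T [S E]]; split; [simpl; now rewrite T |].
split; intros s; unfold legal; simpl; destruct (tile_eq_dec s t); rewrite ?T; auto.
intros K_s L; now apply E.
Qed.

(** This justifies the pretence: a stone at [t] takes no tile that the strategy
    may want, and that [t0] stays empty in [play q t] is harmless because a stone
    of the opponent at [t0] is neither one to build on nor an empty tile. *)
Lemma agrees_on_pretend (P : player) (K : list tile) (p q : position) (t t0 : tile) :
  turn p = opponent P -> agrees_on P K p q -> legal q t ->
  ~ (In t K /\ legal p t) -> agrees_on P K (play p t0) (play q t).
Proof.
intros TP [T [S E]] Lt Hout; split; [simpl; now rewrite T |].
split; intros s; unfold legal; simpl.
- destruct (tile_eq_dec s t0) as [_ | _].
  + rewrite TP; intro H; elim (opponent_neq P); congruence.
  + intro H; apply S in H.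
    destruct (tile_eq_dec s t) as [-> | _]; [unfold legal in Lt; congruence | exact H].
- destruct (tile_eq_dec s t0) as [_ | _]; [discriminate |].
  intros Ks Ls; destruct (tile_eq_dec s t) as [-> | _]; [now elim Hout | now apply E].
Qed.

Lemma common_carrier (P : player) (A : tile -> Prop) (f : tile -> position)
    (L : list tile) :
  (forall t, A t -> exists K n, carries P K n (f t)) ->
  exists K n, forall t, In t L -> A t -> carries P K n (f t).
Proof.
intro H; induction L as [| u L [K [n IH]]]; [exists [], 0; intros t [] |].
destruct (classic (A u)) as [Hu | Hu].
- destruct (H u Hu) as [K' [n' C]]; exists (K' ++ K), (Nat.max n' n).
  intros t [-> | Ht] At.
  + exact (carries_mono _ _ _ _ _ _ (incl_appl _ (incl_refl _)) (Nat.le_max_l _ _) C).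
  + exact (carries_mono _ _ _ _ _ _ (incl_appr _ (incl_refl _)) (Nat.le_max_r _ _)
      (IH t Ht At)).
- exists K, n; intros t [-> | Ht] At; [contradiction | now apply IH].
Qed.

(** Only the moves of the opponent inside [K0] need a carrier of their own;
    every other move is treated as [t0]. *)
Lemma carrier_opponent_move (P : player) (p : position) :
  turn p = opponent P -> (exists t, legal p t) ->
  (forall t, legal p t -> exists K n, carries P K n (play p t)) ->
  exists K n, carries P K n p.
Proof.
intros TP [t0 L0] H.
destruct (H t0 L0) as [K0 [n0 C0]].
destruct (common_carrier P (legal p) (play p) K0 H) as [K [n C]].
(* [t0] is included so that the opponent still has a legal move in [q]. *)
exists (t0 :: K0 ++ K), (Nat.max n0 n); intros q A.
assert (A0 : agrees_on P K0 p q)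
  by (apply (agrees_on_incl _ _ _ _ _ (incl_tl _ (incl_appl _ (incl_refl _))) A)).
assert (A1 : agrees_on P K p q)
  by (apply (agrees_on_incl _ _ _ _ _ (incl_tl _ (incl_appr _ (incl_refl _))) A)).
destruct A as [T [_ E]].
apply ww_opponent; [now rewrite T | exists t0; apply E; simpl; auto |].
intros t Lt; destruct (classic (In t K0 /\ legal p t)) as [[Kt Lp] | Hout].
- apply wins_within_mono with (ord_of_nat n);
    [apply (C t Kt Lp), agrees_on_play, A1 | apply ord_of_nat_le, Nat.le_max_r].
- apply wins_within_mono with (ord_of_nat n0); [| apply ord_of_nat_le, Nat.le_max_l].
  apply C0, agrees_on_pretend; auto.
Qed.

Lemma wins_within_has_carrier (P : player) (a : Ord) (p : position) :
  wins_within P a p -> exists K n, carries P K n p.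
Proof.
induction 1 as [a p W | a b p t T L _ _ [K [n C]] | a p T E _ IH].
- exists [], 0; intros q [_ [S _]]; apply ww_won; exact (won_mono P p q S W).
- exists (t :: K), (S n); intros q A.
  apply (ww_self P _ (ord_of_nat n) q t).
  + now rewrite (proj1 A).
  + apply A; [now left | exact L].
  + apply ord_lt_succ.
  + apply C, agrees_on_play; exact (agrees_on_incl _ _ _ _ _ (incl_tl _ (incl_refl _)) A).
- now apply carrier_opponent_move.
Qed.

Theorem theorem17 (P : player) (p : position) (a : Ord)
  (ha : has_value P p a) : ord_finite a.
Proof.
destruct (proj1 (has_value_iff P p a) ha) as [W M].
destruct (wins_within_has_carrier P a p W) as [K [n C]].
apply ord_le_nat_finite with n, M, C, agrees_on_refl.
Qed.
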